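(* Let $T$ be a finite subset of $\mathbb{R}^n$, and let $S$ be a nonempty and proper subset of $T$. Then $V_T(S)=\emptyset$ if and only if $$\begin{pmatrix}0_n\\-1\end{pmatrix}\in\operatorname{cone}\left\{\begin{pmatrix}t-s\\ \|t\|^2-\|s\|^2\end{pmatrix} : s\in S,\ t\in T\setminus S\right\}\subset\mathbb{R}^{n+1}.$$
   Context: For a finite nonempty set $T\subset\mathbb{R}^n$ and a nonempty proper subset $S\subset T$, the multipoint (higher order) Voronoi cell is $$V_T(S):=\left\{x\in\mathbb{R}^n : \max_{s\in S}\|x-s\|\le\min_{t\in T\setminus S}\|x-t\|\right\},$$ where $\|\cdot\|$ is the Euclidean norm. $\operatorname{cone} A$ denotes the convex cone generated by $A$, i.e. the set of all finite linear combinations of elements of $A$ with nonnegative coefficients. $0_n$ is the zero vector of $\mathbb{R}^n$. *)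

(* Defs.v *)
From mathcomp Require Import all_boot all_order all_algebra finmap.
From mathcomp Require Import classical_sets reals constructive_ereal.

Set Implicit Arguments.
Unset Strict Implicit.
Unset Printing Implicit Defensive.

Import Order.TTheory GRing.Theory Num.Theory.

Local Open Scope classical_set_scope.
Local Open Scope ring_scope.

(* [`|x|] on matrices is the sup norm, hence an explicit Euclidean norm. *)
Definition enorm (R : realType) (n : nat) (x : 'cV[R]_n) : R :=
  Num.sqrt (\sum_(i < n) x i ord0 ^+ 2).

(* The max and the min are taken in [\bar R], where [-oo] and [+oo] are the
   neutral elements; over nonempty finite sets they are the real ones. *)
Definition voronoi (R : realType) (n : nat) (T S : {fset 'cV[R]_n}) :
    set 'cV[R]_n :=
  [set x | (\big[maxe/-oo]_(s <- S) (enorm (x - s))%:E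
            <= \big[mine/+oo]_(t <- (T `\` S)%fset) (enorm (x - t))%:E)%E].

(* [k = 0] is allowed, so that [0] belongs to every cone. *)
Definition cone (R : realType) (V : lmodType R) (A : set V) : set V :=
  [set v | exists (k : nat) (c : 'I_k -> R) (a : 'I_k -> V),
     [/\ forall i, 0 <= c i, forall i, A (a i)
       & v = \sum_(i < k) c i *: a i]].

(* Main.v *)
Require Import Defs.
From mathcomp Require Import all_boot all_order all_algebra finmap.
From mathcomp Require Import boolp classical_sets reals constructive_ereal.
From mathcomp Require Import ring lra.

Set Implicit Arguments.
Unset Strict Implicit.
Unset Printing Implicit Defensive.

Import Order.TTheory GRing.Theory Num.Theory.

Local Open Scope classical_set_scope.
Local Open Scope ring_scope.

(* Expanding squared norms, x lies in the cell iff the vector (2x, -1) has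
   nonpositive inner product with every generator (t - s, |t|^2 - |s|^2).
   Farkas' lemma says that (0, -1) is outside the cone of the generators iff
   some (y, r) has nonpositive inner product with all of them while -r > 0;
   rescaling it to last coordinate -1 gives a point y / (-2r) of the cell.
   Farkas' lemma is proved by Bartl's induction on the number of generators. *)

Section Cone.
Context {R : realType} {V : lmodType R}.
Implicit Types (A B : set V) (u v : V).

Lemma cone0 A : cone A 0.
Proof.
by exists 0%N, (fun=> 0), (fun=> 0); split=> [[]|[]|] //; rewrite big_ord0.
Qed.

Lemma cone_gen A u : A u -> cone A u.
Proof.
move=> Au; exists 1%N, (fun=> 1), (fun=> u); split=> //.
by rewrite big_ord1 scale1r.
Qed.

Lemma coneD A u v : cone A u -> cone A v -> cone A (u + v).
Proof.
move=> [k [c [a [c0 Aa ->]]]] [l [d [b [d0 Ab ->]]]].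
exists (k + l)%N, (fun i => match split i with inl j => c j | inr j => d j end),
  (fun i => match split i with inl j => a j | inr j => b j end).
split=> [i|i|]; [by case: (split i)|by case: (split i)|].
rewrite big_split_ord /=; congr (_ + _); apply: eq_bigr => i _.
  by rewrite (unsplitK (inl i)).
by rewrite (unsplitK (inr i)).
Qed.

Lemma coneZ A r u : 0 <= r -> cone A u -> cone A (r *: u).
Proof.
move=> r0 [k [c [a [c0 Aa ->]]]]; exists k, (fun i => r * c i), a.
split=> // [i|]; first by rewrite mulr_ge0.
by rewrite scaler_sumr; under eq_bigr do rewrite scalerA.
Qed.

(** A cone is closed under sums and nonnegative multiples, so it absorbs combinations of its own
    elements. *)
Lemma cone_sub A B : A `<=` cone B -> cone A `<=` cone B.
Proof.
move=> AB _ [k [c [a [c0 Aa ->]]]].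
elim/big_ind: _ => [|u v|i _]; [exact: cone0|exact: coneD|].
by apply: coneZ => //; apply/AB/Aa.
Qed.

End Cone.

Section InnerProduct.
Context {R : realType}.

Definition dot {n} (u v : 'cV[R]_n) : R := \sum_(i < n) u i ord0 * v i ord0.

Lemma dotDl n (u v w : 'cV[R]_n) : dot (u + v) w = dot u w + dot v w.
Proof. by rewrite -big_split; apply: eq_bigr => i _; rewrite mxE mulrDl. Qed.

Lemma dotZl n r (u v : 'cV[R]_n) : dot (r *: u) v = r * dot u v.
Proof. by rewrite mulr_sumr; apply: eq_bigr => i _; rewrite mxE mulrA. Qed.

Lemma dotC n (u v : 'cV[R]_n) : dot u v = dot v u.
Proof. by apply: eq_bigr => i _; rewrite mulrC. Qed.

Lemma dotBl n (u v w : 'cV[R]_n) : dot (u - v) w = dot u w - dot v w.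
Proof. by rewrite -scaleN1r dotDl dotZl mulN1r. Qed.

Lemma dotBr n (u v w : 'cV[R]_n) : dot u (v - w) = dot u v - dot u w.
Proof. by rewrite dotC dotBl !(dotC u). Qed.

Lemma dotZr n r (u v : 'cV[R]_n) : dot u (r *: v) = r * dot u v.
Proof. by rewrite dotC dotZl dotC. Qed.

Lemma dot0l n (u : 'cV[R]_n) : dot 0 u = 0.
Proof. by rewrite -(scale0r 0) dotZl mul0r. Qed.

Lemma dot_eq0 n (u : 'cV[R]_n) : dot u u <= 0 -> u = 0.
Proof.
move=> u0; have uu i : true -> 0 <= u i ord0 * u i ord0.
  by rewrite -expr2 sqr_ge0.
have /eqP : dot u u = 0 by apply/eqP; rewrite eq_le u0 sumr_ge0.
rewrite psumr_eq0 // => /allP u_eq0; apply/colP => i.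
have := u_eq0 i (mem_index_enum i).
by rewrite /= -expr2 sqrf_eq0 mxE => /eqP.
Qed.

Lemma dot_col_mx m n (u v : 'cV[R]_m) (x y : 'cV[R]_n) :
  dot (col_mx u x) (col_mx v y) = dot u v + dot x y.
Proof.
by rewrite /dot big_split_ord; congr (_ + _); apply: eq_bigr => i _;
  rewrite ?col_mxEu ?col_mxEd.
Qed.

Lemma dot_scalar_mx (a b : R) : dot a%:M b%:M = a * b.
Proof. by rewrite /dot big_ord1 !mxE eqxx !mulr1n. Qed.

Lemma sqr_enorm n (u : 'cV[R]_n) : enorm u ^+ 2 = dot u u.
Proof.
rewrite sqr_sqrtr; last by apply: sumr_ge0 => i _; exact: sqr_ge0.
by apply: eq_bigr => i _; rewrite expr2.
Qed.

(** The easy half of Farkas' lemma: a closed half-space bounded by a hyperplane through the origin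
    is itself a convex cone. *)
Lemma cone_dot_le0 n (A : set 'cV[R]_n) (b x : 'cV[R]_n) :
  cone A b -> (forall u, A u -> dot u x <= 0) -> dot b x <= 0.
Proof.
move=> [k [c [a [c0 Aa ->]]]] Ax.
elim/big_ind: _ => [|u v ux vx|i _]; first by rewrite dot0l.
  by rewrite dotDl; lra.
by rewrite dotZl mulr_ge0_le0 // Ax.
Qed.

Lemma farkas n (s : seq 'cV[R]_n) (b : 'cV[R]_n) :
  (forall x, (forall u, u \in s -> dot u x <= 0) -> dot b x <= 0) ->
  cone [set` s] b.
Proof.
have [m] := ubnP (size s); elim: m => // m IHm in s b *.
case: s => [|a s] /= => [_|size_s] sb.
  (* Without generators every [x] is admissible; [x = b] forces [b = 0]. *)
  by rewrite (@dot_eq0 _ b); [exact: cone0|exact: sb].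
have sub_as : [set` s] `<=` cone [set` a :: s].
  by move=> u us; apply: cone_gen; rewrite /= inE us orbT.
have [/(IHm _ _ size_s)|] :=
  pselect (forall x, (forall u, u \in s -> dot u x <= 0) -> dot b x <= 0).
  exact: cone_sub.
move=> /existsNP[y /not_implyP[sy /negP]]; rewrite -ltNge => by_gt0.
(* Otherwise [y] would satisfy the constraints of [a :: s], and [sb] would contradict [by_gt0]. *)
have ay_gt0 : 0 < dot a y.
  rewrite ltNge; apply: contraTN by_gt0 => ay; rewrite -leNgt; apply: sb => u.
  by rewrite inE => /predU1P[->|/sy].
(* Eliminate [a] by projecting along it onto the hyperplane orthogonal to [z].
   Each projected generator stays in the cone because [dot u z <= 0]. *)
pose z := (dot a y)^-1 *: y.
have az : dot a z = 1 by rewrite dotZr mulVf // gt_eqF.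
have sz u : u \in s -> dot u z <= 0.
  by move=> us; rewrite dotZr pmulr_rle0 ?invr_gt0 // sy.
have bz : 0 <= dot b z by rewrite dotZr mulr_ge0 // ltW // invr_gt0.
have cone_a : cone [set` a :: s] a by apply: cone_gen; rewrite /= inE eqxx.
pose proj u := u - dot u z *: a.
(* The adjoint of [proj] sends [x] to a vector orthogonal to [a], since [dot a z = 1]. *)
have dot_proj u x : dot (proj u) x = dot u (x - dot a x *: z).
  by rewrite dotBl dotBr dotZl (dotZr (dot a x)) mulrC.
(* Here [b] is [proj b] plus a nonnegative multiple of [a], so it remains to place [proj b] in the
   cone. *)
rewrite -(subrK (dot b z *: a) b); apply: coneD; last exact: coneZ.
apply: (@cone_sub _ _ [set` map proj s]).
  move=> _ /mapP[u us ->]; apply: coneD; first exact: sub_as.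
  by rewrite -scaleNr; apply: coneZ; rewrite // oppr_ge0 sz.
apply: IHm => [|x sx]; first by rewrite size_map.
(* Test [sb] on [x - dot a x *: z]: its product with [a] vanishes, and those with [s] are the ones
   assumed in [sx]. *)
rewrite -/(proj b) dot_proj; apply: sb => u.
rewrite inE => /predU1P[->|us].
  by rewrite dotBr (dotZr (dot a x)) az mulr1 subrr.
by rewrite -dot_proj sx ?map_f.
Qed.

End InnerProduct.

(** In $\|x-s\|^2-\|x-t\|^2$ the term $\|x\|^2$ cancels, which leaves $2\langle
    t-s,x\rangle-(\|t\|^2-\|s\|^2)$. *)
Lemma voronoiP (R : realType) (n : nat) (T S : {fset 'cV[R]_n}) x :
  voronoi T S x <->
  forall s t, s \in S -> t \in (T `\` S)%fset ->
    dot (col_mx (t - s) (enorm t ^+ 2 - enorm s ^+ 2)%:M)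
        (col_mx (2 *: x) (-1)%:M) <= 0.
Proof.
have dist_le s t : (dot (col_mx (t - s) (enorm t ^+ 2 - enorm s ^+ 2)%:M)
    (col_mx (2 *: x) (-1)%:M) <= 0) = (enorm (x - s) <= enorm (x - t)).
  rewrite -[RHS]ler_sqr ?nnegrE ?sqrtr_ge0 // !sqr_enorm.
  rewrite dot_col_mx dot_scalar_mx !(dotBl, dotBr, dotZr).
  rewrite (dotC s x) (dotC t x) -[RHS]subr_le0; congr (_ <= 0); ring.
split=> [xV s t sS tTS|xV].
  rewrite dist_le -lee_fin; apply: le_trans (le_trans xV _).
    exact: le_bigmax_seq sS _.
  exact: ge_bigmin_seq tTS _.
rewrite /voronoi /= big_seq; apply: bigmax_le => [|s sS]; first exact: leNye.
rewrite big_seq; apply: le_bigmin => [|t tTS]; first exact: leey.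
by rewrite lee_fin -dist_le xV.
Qed.

Theorem theorem2p1 (R : realType) (n : nat) (T S : {fset 'cV[R]_n})
    (S_neq0 : S != fset0) (S_proper : (S `<` T)%fset) :
  voronoi T S = set0 <->
  cone [set col_mx (t - s) (enorm t ^+ 2 - enorm s ^+ 2)%:M
         | s in [set` S] & t in [set` (T `\` S)%fset]]
    (col_mx (0 : 'cV[R]_n) (- 1)%:M : 'cV[R]_(n + 1)).
Proof.
split=> [V0|coneG]; last first.
  rewrite -subset0 => x /voronoiP xV.
  (* This product equals 1, hence the contradiction. *)
  have : dot (col_mx 0 (-1)%:M) (col_mx (2 *: x) (-1)%:M) <= 0.
    by apply: cone_dot_le0 coneG _ => _ [s sS [t tTS <-]]; exact: xV.
  by rewrite dot_col_mx dot0l dot_scalar_mx; lra.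
(* [farkas] expects a list, so the generators are enumerated over all pairs. *)
pose gen s t : 'cV[R]_(n + 1) :=
  col_mx (t - s) (enorm t ^+ 2 - enorm s ^+ 2)%:M.
apply: (@cone_sub _ _ [set` [seq gen s t | s <- S, t <- (T `\` S)%fset]]).
  move=> _ /allpairsP[[s t] /= [sS tTS ->]]; apply: cone_gen.
  by exists s => //; exists t.
apply: farkas => z; rewrite -(vsubmxK z).
set y := usubmx z; rewrite [dsubmx z]mx11_scalar; set r := dsubmx z 0 0 => genz.
rewrite dot_col_mx dot0l dot_scalar_mx add0r mulN1r leNgt; apply/negP => nr_gt0.
(* The factor [2^-1] cancels the 2 in [voronoiP]; [(- r)^-1] rescales [z] to last coordinate -1. *)
suff : voronoi T S (2^-1 *: ((- r)^-1 *: y)) by rewrite V0.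
apply/voronoiP => s t sS tTS.
have := genz (gen s t) (allpairs_f _ sS tTS).
rewrite (scalerA 2) mulfV ?pnatr_eq0 // scale1r !dot_col_mx !dot_scalar_mx.
(* Multiplying by the positive number [- r] undoes the rescaling and recovers the inequality given
   by [genz]. *)
rewrite dotZr -(pmulr_rle0 (_ + _ * -1) nr_gt0) mulrDr mulrA mulfV ?gt_eqF //.
by rewrite mul1r mulrCA mulrNN mulr1.
Qed.
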